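(* Let $A_1$ and $A_2$ be Banach algebras and let $\theta\in\Delta_0(A_2)$. Then the following statements hold. (i) $A_1\times_\theta A_2$ is 0-point amenable if and only if $A_1$ and $A_2$ are 0-point amenable. (ii) $A_1\oplus A_2$ is 0-point amenable if and only if $A_1$ and $A_2$ are 0-point amenable. (iii) $A_1$ is 0-point amenable if and only if $A_1^\sharp$ is 0-point amenable.
   Context: For a Banach algebra $A$, $\Delta(A)$ is the character space of $A$ (nonzero multiplicative linear functionals) and $\Delta_0(A)=\Delta(A)\cup\{0\}$. A continuous point derivation of $A$ at $\varphi\in\Delta_0(A)$ is a continuous linear functional $d$ on $A$ with $d(ab)=d(a)\varphi(b)+\varphi(a)d(b)$ for all $a,b\in A$. $A$ is 0-point amenable if there is no nonzero continuous point derivation of $A$ at any element of $\Delta_0(A)$. For $\theta\in\Delta_0(A_2)$, the $\theta$-Lau product $A_1\times_\theta A_2$ is the space $A_1\times A_2$ with product $(a_1,a_2)(x_1,x_2)=(a_1x_1+a_1\theta(x_2)+x_1\theta(a_2),\,a_2x_2)$ and norm $\|(a_1,a_2)\|=\|a_1\|+\|a_2\|$. For $\theta=0$ it is the usual direct product $A_1\oplus A_2$; for $A_2=\mathbb{C}$ and $\theta$ the identity map on $\mathbb{C}$ it is $A_1^\sharp$, the unitization of $A_1$. *)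

(* Defs.v *)
From HB Require Import structures.
From mathcomp Require Import all_boot all_order all_algebra.
From mathcomp Require Import complex.
From mathcomp Require Import all_classical all_reals topology normedtype sequences.
From mathcomp Require Import ring.

Set Implicit Arguments.
Unset Strict Implicit.
Unset Printing Implicit Defensive.

Import Order.TTheory GRing.Theory Num.Theory.
Import numFieldNormedType.Exports.

Local Open Scope classical_set_scope.
Local Open Scope complex_scope.
Local Open Scope ring_scope.

(* The product is a new operation rather than the one of a [pzRingType]: a
   Banach algebra need not have a unit. *)
HB.mixin Record isBanachAlgebra (K : numFieldType) A
    & CompleteNormedModule K A := {
  bmul : A -> A -> A;
  bmulA : associative bmul;
  bmulDl : left_distributive bmul +%R;
  bmulDr : right_distributive bmul +%R;
  bmulZl : forall (k : K) (a b : A), bmul (k *: a) b = k *: bmul a b;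
  bmulZr : forall (k : K) (a b : A), bmul a (k *: b) = k *: bmul a b;
  ler_norm_bmul : forall a b : A, `|bmul a b| <= `|a| * `|b|
}.

#[short(type="banachAlgType")]
HB.structure Definition BanachAlgebra (K : numFieldType) :=
  {A of CompleteNormedModule K A & isBanachAlgebra K A}.

Section Complex.
Variable R : realType.

Lemma cauchy_fmap (K L : numFieldType) (U : pseudoMetricType K)
    (V : pseudoMetricType L) (f : U -> V) (F : set_system U) :
  Filter F ->
  (forall e : L, 0 < e -> exists2 d : K, 0 < d &
     forall x y, ball x d y -> ball (f x) e (f y)) ->
  cauchy F -> cauchy (f @ F).
Proof.
move=> FF fu /cauchy_ballP Fc; apply/cauchy_ballP => e /fu [d d0 fd].
have [[A B] /= [FA FB] AB] := Fc d d0.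
exists (f @` A, f @` B).
  by split; rewrite /= /fmap /=; [apply: filterS FA|apply: filterS FB] => x ?;
     exists x.
by move=> [_ _] [/= [x Ax <-] [y By <-]]; apply/fd/(AB (x, y)).
Qed.

Lemma normc_ge_Im (x : R[i]) : `|complex.Im x|%:C <= `|x|.
Proof.
by case: x => a b; simpc; rewrite -sqrtr_sqr ler_wsqrtr // lerDr sqr_ge0.
Qed.

Lemma complex_complete (F : set_system (R[i])^o) :
  ProperFilter F -> cauchy F -> cvg F.
Proof.
move=> FF Fc.
have cRe : cauchy ((@complex.Re R) @ F).
  apply: cauchy_fmap Fc => e e0; exists e%:C; first by rewrite ltcR.
  move=> x y; rewrite -!ball_normE /ball_ /= => xy.
  by rewrite -ltcR; apply: le_lt_trans xy; rewrite -raddfB; exact: normc_ge_Re.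
have cIm : cauchy ((@complex.Im R) @ F).
  apply: cauchy_fmap Fc => e e0; exists e%:C; first by rewrite ltcR.
  move=> x y; rewrite -!ball_normE /ball_ /= => xy.
  by rewrite -ltcR; apply: le_lt_trans xy; rewrite -raddfB; exact: normc_ge_Im.
move/cauchy_cvg/cvg_ex : cRe => [a Fa].
move/cauchy_cvg/cvg_ex : cIm => [b Fb].
apply/cvg_ex; exists (a +i* b).
apply/cvgrPdist_lt => e e0.
have eE : e = (complex.Re e)%:C by rewrite RRe_real// gtr0_real.
have e20 : 0 < complex.Re e / 2 by rewrite divr_gt0// -ltcR -eE.
near=> z.
have -> : (a +i* b : (R[i])^o) - z =
    (a - complex.Re z)%:C + 'i%C * (b - complex.Im z)%:C.
  by rewrite [LHS]complexE !raddfB.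
apply: le_lt_trans (ler_normD _ _) _.
rewrite normrM.
have -> : `|'i%C : R[i]| = 1 by rewrite normc_def /= expr0n add0r expr1n sqrtr1.
rewrite mul1r !normc_def /= expr0n !addr0 !sqrtr_sqr -rmorphD /= eE ltcR.
rewrite [ltRHS]splitr ltrD//.
- by near: z; move/cvgrPdist_lt : Fa; apply.
- by near: z; move/cvgrPdist_lt : Fb; apply.
Unshelve. all: by end_near. Qed.

End Complex.

(* An alias is needed to declare the instances below: [(R[i])^o] would be
   searched under the key [GRing.regular], already taken by [R^o]. *)
Definition complex_algebra (R : realType) : Type := (R[i])^o.

Section ComplexAlgebra.
Variable R : realType.
Local Notation C := (complex_algebra R).

HB.instance Definition _ := NormedModule.copy C (R[i])^o.
HB.instance Definition _ := Uniform_isComplete.Build C (@complex_complete R).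

Definition complex_mul (x y : C) : C := (x : R[i]) * (y : R[i]).

Let cmulA : associative complex_mul.
Proof. exact: (@mulrA R[i]). Qed.
Let cmulDl : left_distributive complex_mul +%R.
Proof. exact: (@mulrDl R[i]). Qed.
Let cmulDr : right_distributive complex_mul +%R.
Proof. exact: (@mulrDr R[i]). Qed.
Let cmulZl (k : R[i]) (a b : C) : complex_mul (k *: a) b = k *: complex_mul a b.
Proof. exact/esym/(@mulrA R[i]). Qed.
Let cmulZr (k : R[i]) (a b : C) : complex_mul a (k *: b) = k *: complex_mul a b.
Proof. exact: (@mulrCA R[i]). Qed.
Let cmul_norm (a b : C) : `|complex_mul a b| <= `|a| * `|b|.
Proof. by have := lexx (`|a| * `|b|); rewrite -{1}(@normrM R[i]). Qed.

HB.instance Definition _ := isBanachAlgebra.Build R[i] C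
  cmulA cmulDl cmulDr cmulZl cmulZr cmul_norm.

End ComplexAlgebra.

Section CharacterSpace.
Variable R : realType.
Implicit Type A : banachAlgType R[i].

Definition char_space A : set (A -> R[i]) :=
  [set phi | [/\ scalar phi,
                 forall a b, phi (bmul a b) = phi a * phi b &
                 phi <> (fun=> 0)]].
Arguments char_space A : clear implicits.

Definition char_space0 A : set (A -> R[i]) :=
  char_space A `|` [set fun=> 0].
Arguments char_space0 A : clear implicits.

Definition cont_point_derivation A (phi d : A -> R[i]) : Prop :=
  [/\ scalar d, continuous (d : A -> (R[i])^o) &
      forall a b, d (bmul a b) = d a * phi b + phi a * d b].

Definition zero_point_amenable A : Prop :=
  ~ exists phi d : A -> R[i],
      [/\ char_space0 A phi, cont_point_derivation phi d & d <> (fun=> 0)].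

End CharacterSpace.
Arguments char_space {R} A.
Arguments char_space0 {R} A.

Section Contractive.
Variable (R : realType).
Implicit Type A : banachAlgType R[i].

Lemma bmulr0 A (b : A) : bmul b 0 = 0.
Proof. by have := bmulZr 0 b 0; rewrite !scale0r. Qed.

Lemma bmulrB A (b x y : A) : bmul b (x - y) = bmul b x - bmul b y.
Proof. by rewrite bmulDr -scaleN1r bmulZr scaleN1r. Qed.

Lemma quasi_inverse A (b : A) : `|b| < 1 -> exists y, y = b + bmul b y.
Proof.
move=> b1; pose s n := iter n (fun y => b + bmul b y) 0.
have r1 : 0 < 1 - `|b| by rewrite subr_gt0.
have sM n : `|s n| <= (1 - `|b|)^-1.
  elim: n => [|n IH]; first by rewrite normr0 invr_ge0 ltW.
  apply: le_trans (ler_normD _ _) _.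
  apply: le_trans (lerD (lexx _) (ler_norm_bmul _ _)) _.
  apply: le_trans (lerD (lexx _) (ler_wpM2l (normr_ge0 _) IH)) _.
  rewrite -(ler_pM2r r1) mulVf ?gt_eqF// mulrDl mulfVK ?gt_eqF//.
  rewrite mulrBr mulr1 -subr_ge0.
  have -> : 1 - (`|b| - `|b| * `|b| + `|b|) = (1 - `|b|) ^+ 2. by ring.
  by rewrite exprn_ge0// ltW.
have sD n m : `|s (n + m)%N - s n| <= `|b| ^+ n * (1 - `|b|)^-1.
  elim: n => [|n IH]; first by rewrite add0n subr0 expr0 mul1r.
  rewrite addSn /s !iterS -!/(s _) opprD addrACA subrr add0r -bmulrB.
  apply: le_trans (ler_norm_bmul _ _) _.
  by rewrite exprS -mulrA ler_wpM2l.
have sc : cauchy (s @ \oo).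
  apply: cauchy_exP => e e0.
  have ee : 0 < e * (1 - `|b|) by rewrite mulr_gt0.
  have [N bN] : exists N, `|b| ^+ N < e * (1 - `|b|).
    have bE : `|b| = (complex.Re `|b|)%:C by rewrite RRe_real// normr_real.
    have eE : e * (1 - `|b|) = (complex.Re (e * (1 - `|b|)))%:C.
      by rewrite RRe_real// gtr0_real.
    have Rb0 : 0 <= complex.Re `|b| by rewrite -lecR -bE; exact: normr_ge0.
    have : `|complex.Re `|b| | < 1 by rewrite ger0_norm// -ltcR -bE; exact: b1.
    move/cvg_expr/cvgrPdist_lt => /(_ (complex.Re (e * (1 - `|b|)))).
    rewrite -ltcR -eE => /(_ ee) [N _ /(_ N (leqnn N))] /=.
    rewrite sub0r normrN normrX ger0_norm// => h; exists N.
    by move: h; rewrite -ltcR -eE rmorphXn /= -bE.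
  exists (s N); exists N => // n /= Nn.
  rewrite -ball_normE /ball_ /= distrC -(subnKC Nn).
  by apply: le_lt_trans (sD _ _) _; rewrite ltr_pdivrMr.
move/cauchy_cvg/cvg_ex : sc => [y sy]; exists y.
have sy' : s n.+1 @[n --> \oo] --> y by rewrite (cvg_shiftS s).
apply: (cvg_unique _ sy') => //=.
apply: cvgD; first exact: cvg_cst.
apply/cvgrPdist_lt => e e0; near=> n.
rewrite -bmulrB; apply: le_lt_trans (ler_norm_bmul _ _) _.
apply: le_lt_trans (ler_piMl (normr_ge0 _) (ltW b1)) _.
by near: n; move/cvgrPdist_lt : sy; apply.
Unshelve. all: by end_near. Qed.

Lemma char_space0_scalar A (phi : A -> R[i]) : char_space0 A phi -> scalar phi.
Proof. by case=> [[]//|->] k x y /=; rewrite mulr0 addr0. Qed.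

Lemma char_space0M A (phi : A -> R[i]) (a b : A) :
  char_space0 A phi -> phi (bmul a b) = phi a * phi b.
Proof. by case=> [[]//|->]; rewrite mulr0. Qed.

Lemma char_space0_contractive A (phi : A -> R[i]) (a : A) :
  char_space0 A phi -> `|phi a| <= `|a|.
Proof.
move=> phi0.
have phiD x y : phi (x + y) = phi x + phi y.
  by have := char_space0_scalar phi0 1 x y; rewrite scale1r mul1r.
have phi00 : phi 0 = 0.
  by apply: (addrI (phi 0)); rewrite -phiD !addr0.
have phiZ k x : phi (k *: x) = k * phi x.
  by have := char_space0_scalar phi0 k x 0; rewrite phi00 !addr0.
rewrite real_leNgt ?normr_real//; apply/negP => lt_a.
have pa0 : phi a != 0.
  by rewrite -normr_gt0; apply: le_lt_trans lt_a; rewrite normr_ge0.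
pose b := (phi a)^-1 *: a.
have b1 : `|b| < 1.
  by rewrite normrZ normfV mulrC ltr_pdivrMr ?mul1r ?normr_gt0.
have [y /(congr1 phi)] := quasi_inverse b1.
rewrite phiD (char_space0M _ _ phi0) phiZ mulVf// mul1r => /eqP.
by rewrite -subr_eq subrr eq_sym oner_eq0.
Qed.

End Contractive.

Section LauProduct.
Variables (R : realType) (A1 A2 : banachAlgType R[i]).

Definition lau_prod (theta : char_space0 A2) : Type := (A1 * A2)%type.

Variable theta : char_space0 A2.
Local Notation L := (lau_prod theta).
Local Notation th := (\val theta : A2 -> R[i]).

HB.instance Definition _ := GRing.Lmodule.copy L (A1 * A2)%type.

(* [A1 * A2] carries the max norm in the library, hence the alias [lau_prod]. *)
Definition lau_norm (x : L) : R[i] := `|x.1| + `|x.2|.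

Let lau_normD (x y : L) : lau_norm (x + y) <= lau_norm x + lau_norm y.
Proof. by rewrite /lau_norm addrACA lerD// ler_normD. Qed.

Let lau_normZ (k : R[i]) (x : L) : lau_norm (k *: x) = `|k| * lau_norm x.
Proof. by rewrite /lau_norm !normrZ mulrDr. Qed.

Let lau_norm0_eq0 (x : L) : lau_norm x = 0 -> x = 0.
Proof.
case: x => a b /eqP; rewrite /lau_norm paddr_eq0 ?normr_ge0//= !normr_eq0.
by move=> /andP[/eqP-> /eqP->].
Qed.

HB.instance Definition _ :=
  Lmodule_isNormed.Build R[i] L lau_normD lau_normZ lau_norm0_eq0.

Lemma lau_normE (x : L) : `|x| = `|x.1| + `|x.2|. Proof. by []. Qed.

Let lau_complete (F : set_system L) : ProperFilter F -> cauchy F -> cvg F.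
Proof.
move=> FF Fc.
have c1 : cauchy ((fun x : L => x.1) @ F).
  apply: cauchy_fmap Fc => e e0; exists e => // x y.
  rewrite -!ball_normE /ball_ /= => xy; apply: le_lt_trans xy.
  by rewrite lau_normE lerDl.
have c2 : cauchy ((fun x : L => x.2) @ F).
  apply: cauchy_fmap Fc => e e0; exists e => // x y.
  rewrite -!ball_normE /ball_ /= => xy; apply: le_lt_trans xy.
  by rewrite lau_normE lerDr.
move/cauchy_cvg/cvg_ex : c1 => [a Fa].
move/cauchy_cvg/cvg_ex : c2 => [b Fb].
apply/cvg_ex; exists ((a, b) : L).
apply/cvgrPdist_lt => e e0.
near=> z.
rewrite lau_normE /= [ltRHS]splitr ltrD//.
- by near: z; move/cvgrPdist_lt : Fa; apply; rewrite divr_gt0.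
- by near: z; move/cvgrPdist_lt : Fb; apply; rewrite divr_gt0.
Unshelve. all: by end_near. Qed.

HB.instance Definition _ := Uniform_isComplete.Build L lau_complete.

Definition lau_mul (a x : L) : L :=
  (bmul a.1 x.1 + th x.2 *: a.1 + th a.2 *: x.1, bmul a.2 x.2).

Let th0 : char_space0 A2 th. Proof. exact: set_valP. Qed.

Let thM a b : th (bmul a b) = th a * th b.
Proof. exact: char_space0M. Qed.

Let thL k a b : th (k *: a + b) = k * th a + th b.
Proof. exact: char_space0_scalar. Qed.

Let thD a b : th (a + b) = th a + th b.
Proof. by have := thL 1 a b; rewrite scale1r mul1r. Qed.

Let thZ k a : th (k *: a) = k * th a.
Proof.
have t0 : th 0 = 0 by apply: (addrI (th 0)); rewrite -thD !addr0.
by have := thL k a 0; rewrite t0 !addr0.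
Qed.

Let lauD1 (x y : L) : (x + y).1 = x.1 + y.1. Proof. by []. Qed.
Let lauD2 (x y : L) : (x + y).2 = x.2 + y.2. Proof. by []. Qed.
Let lauZ1 (k : R[i]) (x : L) : (k *: x).1 = k *: x.1. Proof. by []. Qed.
Let lauZ2 (k : R[i]) (x : L) : (k *: x).2 = k *: x.2. Proof. by []. Qed.
Let lauM1 (x y : L) :
  (lau_mul x y).1 = bmul x.1 y.1 + th y.2 *: x.1 + th x.2 *: y.1.
Proof. by []. Qed.
Let lauM2 (x y : L) : (lau_mul x y).2 = bmul x.2 y.2. Proof. by []. Qed.
Let lauE := (lauM1, lauM2, lauD1, lauD2, lauZ1, lauZ2).

Let lau_mulA : associative lau_mul.
Proof.
move=> x y z; apply: injective_projections; rewrite !lauE ?bmulA//.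
rewrite !thM !bmulDr !bmulDl !scalerDr !bmulZl !bmulZr !scalerA bmulA.
rewrite [LHS](AC (3*1*3) ((1*3*5)*(2*4*6)*7)) /=.
by rewrite [th z.2 * th y.2]mulrC [th z.2 * th x.2]mulrC.
Qed.

Let lau_mulDl : left_distributive lau_mul +%R.
Proof.
move=> x y z; apply: injective_projections; rewrite !lauE ?bmulDl//.
by rewrite thD scalerDr scalerDl [LHS](AC (2*2*2) ((1*3*5)*(2*4*6))).
Qed.

Let lau_mulDr : right_distributive lau_mul +%R.
Proof.
move=> x y z; apply: injective_projections; rewrite !lauE ?bmulDr//.
by rewrite thD scalerDr scalerDl [LHS](AC (2*2*2) ((1*3*5)*(2*4*6))).
Qed.

Let lau_mulZl (k : R[i]) (x y : L) : lau_mul (k *: x) y = k *: lau_mul x y.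
Proof.
apply: injective_projections; rewrite !lauE ?bmulZl//.
by rewrite thZ !scalerDr !scalerA [th y.2 * k]mulrC.
Qed.

Let lau_mulZr (k : R[i]) (x y : L) : lau_mul x (k *: y) = k *: lau_mul x y.
Proof.
apply: injective_projections; rewrite !lauE ?bmulZr//.
by rewrite thZ !scalerDr !scalerA [th x.2 * k]mulrC.
Qed.

Let lau_mul_norm (x y : L) : `|lau_mul x y| <= `|x| * `|y|.
Proof.
rewrite !lau_normE !lauE.
have thc a : `|th a| <= `|a| by exact: char_space0_contractive.
have -> : (`|x.1| + `|x.2|) * (`|y.1| + `|y.2|) =
    `|x.1| * `|y.1| + `|y.2| * `|x.1| + `|x.2| * `|y.1| + `|x.2| * `|y.2|.
  by ring.
rewrite lerD ?ler_norm_bmul//.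
apply: le_trans (ler_normD _ _) _; rewrite lerD//.
  apply: le_trans (ler_normD _ _) _; rewrite lerD ?ler_norm_bmul//.
  by rewrite normrZ ler_wpM2r.
by rewrite normrZ ler_wpM2r.
Qed.

HB.instance Definition _ := isBanachAlgebra.Build R[i] L
  lau_mulA lau_mulDl lau_mulDr lau_mulZl lau_mulZr lau_mul_norm.

End LauProduct.

Section DirectSumUnitization.
Variable R : realType.
Implicit Type A : banachAlgType R[i].

Lemma zero_in_char_space0 A : (fun=> 0) \in char_space0 A.
Proof. by apply/mem_set; right. Qed.

Definition zero_char A : char_space0 A := SigSub (zero_in_char_space0 A).

Lemma id_in_char_space0 :
  (fun z => z : R[i]) \in char_space0 (complex_algebra R).
Proof.
apply/mem_set; left; split => //.
by move=> /(congr1 (fun f => f 1)) /eqP; rewrite oner_eq0.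
Qed.

Definition id_char : char_space0 (complex_algebra R) :=
  SigSub id_in_char_space0.

Definition direct_sum (A1 A2 : banachAlgType R[i]) : banachAlgType R[i] :=
  lau_prod A1 (zero_char A2).

Definition unitization (A : banachAlgType R[i]) : banachAlgType R[i] :=
  lau_prod A id_char.

End DirectSumUnitization.

(* Main.v *)
(** Algebra homomorphisms pull characters and point derivations back. Both
    factors of the Lau product embed in it by homomorphisms and together they
    span it, so a point derivation of the product vanishes as soon as its two
    restrictions do. Conversely, point derivations of the second factor lift
    along the projection, and a point derivation [d] of the first factor at
    [phi] extends to [(a, b) |-> d a], a point derivation at
    [(a, b) |-> phi a + theta b]. The unitization is the case where the second
    factor is the complex field, which is 0-point amenable because a point
    derivation kills the idempotent [1]. *)
Require Import Defs.
From mathcomp Require Import all_boot all_order all_algebra.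
From mathcomp Require Import complex.
From mathcomp Require Import all_classical all_reals.
From mathcomp Require Import topology normedtype ring.

Import Order.TTheory GRing.Theory Num.Theory.
Import numFieldNormedType.Exports.

Local Open Scope complex_scope.
Local Open Scope ring_scope.

Lemma nonexpansive_continuous {K : numFieldType} {U V : normedModType K}
    {f : U -> V} : (forall x y, `|f x - f y| <= `|x - y|) -> continuous f.
Proof.
move=> fle x; apply/cvgrPdist_lt => e e0; near=> y.
by apply: le_lt_trans (fle x y) _; near: y; exact: cvgr_dist_lt.
Unshelve. all: by end_near. Qed.

Section PointDerivations.
Context {R : realType}.
Implicit Types A B : banachAlgType R[i].

Lemma scalarD {A} {f : A -> R[i]} : scalar f -> {morph f : a b / a + b}.
Proof. by move=> fL a b; have := fL 1 a b; rewrite scale1r mul1r. Qed.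

Lemma scalarZ {A} {f : A -> R[i]} : scalar f ->
  forall k, {morph f : a / k *: a >-> k * a}.
Proof. exact: GRing.scalable_linear. Qed.

(** Adjoining 0 to the characters removes the nonvanishing condition, so membership can be checked
    by equations alone, with no case split on whether [phi] is zero. *)
Lemma char_space0P A (phi : A -> R[i]) :
  char_space0 A phi <->
  scalar phi /\ (forall a b, phi (bmul a b) = phi a * phi b).
Proof.
split=> [phi0|[phiL phiM]].
  by split; [exact: char_space0_scalar|move=> a b; exact: char_space0M].
by have [phi0|phi0] := pselect (phi = fun=> 0); [right|left; split].
Qed.

Lemma zero_point_amenableP A :
  zero_point_amenable A <->
  (forall phi d : A -> R[i], char_space0 A phi ->
     cont_point_derivation phi d -> d = fun=> 0).
Proof.
split=> [nA phi d phi0 dP|h [phi [d [phi0 dP]]]]; last by apply; exact: h dP.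
by apply: contrapT => d0; apply: nA; exists phi, d.
Qed.

Section Pullback.
Context {A B : banachAlgType R[i]} {f : A -> B}.
Context (fL : linear f) (fM : {morph f : a b / bmul a b}).

(** A nonzero character may vanish on the range of [f]; its pullback then stays in [char_space0],
    though not in [char_space]. *)
Lemma char_space0_comp {phi : B -> R[i]} :
  char_space0 B phi -> char_space0 A (phi \o f).
Proof.
move=> /char_space0P[phiL phiM]; apply/char_space0P.
by split=> [k a b|a b] /=; rewrite ?fL ?fM ?phiL ?phiM.
Qed.

Lemma cont_point_derivation_comp {phi d : B -> R[i]} : continuous f ->
  cont_point_derivation phi d -> cont_point_derivation (phi \o f) (d \o f).
Proof.
move=> fc [dL dc dM]; split=> [k a b|a|a b] /=; rewrite ?fL ?fM ?dL ?dM//.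
exact: (@continuous_comp A B (R[i])^o f d a (fc a) (dc (f a))).
Qed.

End Pullback.

Lemma zero_point_amenable_complex : zero_point_amenable (complex_algebra R).
Proof.
apply/zero_point_amenableP => phi d /char_space0P[_ phiM] [dL _ dM].
pose e : complex_algebra R := (1 : R[i]).
have eK (z : complex_algebra R) : bmul z e = z by exact: (@mulr1 R[i]).
have phie : phi e * phi e = phi e by rewrite -phiM eK.
have de : d e = d e * phi e + phi e * d e by rewrite -{1}(eK e) dM.
(* The idempotent scalar [phi e] is 0 or 1, and [de] then reads [d e = 0] or [d e = d e + d e]. *)
have de0 : d e = 0.
  have /eqP : phi e * (phi e - 1) = 0 by rewrite mulrBr phie mulr1 subrr.
  rewrite mulf_eq0 subr_eq0 => /orP[] /eqP h.
    by rewrite de h mulr0 mul0r addr0.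
  by apply: (addrI (d e)); rewrite addr0 {3}de h mulr1 mul1r.
have d0 : d 0 = 0 by have := dL (-1) e e; rewrite de0 scaleN1r addNr mulr0 addr0.
apply/funext => z.
(* The summand 0 gives [z] the shape [k *: a + b] that [dL] expects. *)
have -> : z = (z : R[i]) *: e + 0 by rewrite addr0; exact/esym/(@mulr1 R[i]).
by rewrite dL de0 mulr0 d0 addr0.
Qed.

End PointDerivations.

Section LauProduct.
Context {R : realType} (A1 A2 : banachAlgType R[i]) (theta : char_space0 A2).
Local Notation L := (lau_prod A1 theta).
Local Notation th := (sval theta : A2 -> R[i]).

Definition lau_inl (a : A1) : L := (a, 0).
Definition lau_inr (b : A2) : L := (0, b).

Let thP : scalar th /\ (forall a b, th (bmul a b) = th a * th b).
Proof. by apply/char_space0P; exact: set_valP. Qed.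

Let th0 : th 0 = 0.
Proof.
by have := thP.1 (-1) 0 0; rewrite scaleN1r addNr mulN1r addNr.
Qed.

Lemma lau_inl_linear : linear lau_inl.
Proof.
by move=> k a b; apply: injective_projections => //=; rewrite scaler0 addr0.
Qed.

Lemma lau_inr_linear : linear lau_inr.
Proof.
by move=> k a b; apply: injective_projections => //=; rewrite scaler0 addr0.
Qed.

(** Both cross terms of the product carry the factor [th 0 = 0]. *)
Lemma lau_inlM : {morph lau_inl : a b / bmul a b}.
Proof.
move=> a b; apply: injective_projections => /=; last by rewrite bmulr0.
by rewrite th0 !scale0r !addr0.
Qed.

Lemma lau_inrM : {morph lau_inr : a b / bmul a b}.
Proof.
move=> a b; apply: injective_projections => //=.
by rewrite bmulr0 !scaler0 !addr0.
Qed.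

Lemma lau_inl_continuous : continuous lau_inl.
Proof.
by apply: nonexpansive_continuous => x y; rewrite lau_normE /= subr0 normr0 addr0.
Qed.

Lemma lau_inr_continuous : continuous lau_inr.
Proof.
by apply: nonexpansive_continuous => x y; rewrite lau_normE /= subr0 normr0 add0r.
Qed.

Lemma lau_fst_continuous : continuous (fun x : L => x.1).
Proof.
by apply: nonexpansive_continuous => x y; rewrite lau_normE /= lerDl.
Qed.

Lemma lau_snd_continuous : continuous (fun x : L => x.2).
Proof.
by apply: nonexpansive_continuous => x y; rewrite lau_normE /= lerDr.
Qed.

(** The first projection is not multiplicative in general. The summand [th x.2] repairs this: the
    mixed terms of [(phi a + th b) * (phi x + th y)] are the images under [phi] of the cross terms
    of the product. *)
Lemma char_space0_lau {phi : A1 -> R[i]} : char_space0 A1 phi ->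
  char_space0 L (fun x => phi x.1 + th x.2).
Proof.
have [thL thM] := thP.
move=> /char_space0P[phiL phiM]; apply/char_space0P; split=> [k x y|x y] /=.
  by rewrite phiL thL; ring.
by rewrite (scalarD phiL) (scalarD phiL) !(scalarZ phiL) phiM thM; ring.
Qed.

(** Applied to the cross terms, [d] yields [th y * d a + th b * d x], which is what the [th] part of
    the new functional adds to the derivation rule. *)
Lemma cont_point_derivation_lau {phi d : A1 -> R[i]} :
  cont_point_derivation phi d ->
  @cont_point_derivation R L (fun x => phi x.1 + th x.2) (fun x => d x.1).
Proof.
move=> [dL dc dM]; split=> [k x y|x|x y] /=.
- by rewrite dL.
- exact: (@continuous_comp L A1 (R[i])^o _ d x (lau_fst_continuous x) (dc _)).
- by rewrite !(scalarD dL) !(scalarZ dL) dM; ring.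
Qed.

Lemma zero_point_amenable_lau :
  zero_point_amenable L <-> zero_point_amenable A1 /\ zero_point_amenable A2.
Proof.
split=> [/zero_point_amenableP LP|[/zero_point_amenableP P1 +]]; last first.
  move=> /zero_point_amenableP P2.
  apply/zero_point_amenableP => phi d phi0 dP; apply/funext => x.
  have /(congr1 (@^~ x.1)) /= d1 :=
    P1 _ _ (char_space0_comp lau_inl_linear lau_inlM phi0)
      (cont_point_derivation_comp lau_inl_linear lau_inlM lau_inl_continuous dP).
  have /(congr1 (@^~ x.2)) /= d2 :=
    P2 _ _ (char_space0_comp lau_inr_linear lau_inrM phi0)
      (cont_point_derivation_comp lau_inr_linear lau_inrM lau_inr_continuous dP).
  have -> : x = 1 *: lau_inl x.1 + lau_inr x.2.
    by rewrite scale1r; apply: injective_projections => /=; rewrite ?addr0 ?add0r.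
  by case: dP => dL _ _; rewrite dL d1 d2 mulr0 addr0.
split; apply/zero_point_amenableP => phi d phi0 dP; apply/funext => a.
  have := LP _ _ (char_space0_lau phi0) (cont_point_derivation_lau dP).
  by move/(congr1 (@^~ (lau_inl a))).
(* Unlike the first projection, the second one is a homomorphism for every [theta]. *)
have sL : linear (fun x : L => x.2) by [].
have sM : {morph (fun x : L => x.2) : x y / bmul x y} by [].
have := LP _ _ (char_space0_comp sL sM phi0)
  (cont_point_derivation_comp sL sM lau_snd_continuous dP).
by move/(congr1 (@^~ (lau_inr a))).
Qed.

End LauProduct.

Theorem theorem3p1 (R : realType) (A1 A2 : banachAlgType R[i])
    (theta : char_space0 A2) :
  [/\ zero_point_amenable (lau_prod A1 theta) <->
        zero_point_amenable A1 /\ zero_point_amenable A2,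
      zero_point_amenable (direct_sum A1 A2) <->
        zero_point_amenable A1 /\ zero_point_amenable A2 &
      zero_point_amenable A1 <-> zero_point_amenable (unitization A1)].
Proof.
(* The direct sum and the unitization are by definition Lau products, for [zero_char] and
   [id_char]. *)
split; [exact: zero_point_amenable_lau|exact: zero_point_amenable_lau|].
split=> [P1|/zero_point_amenable_lau[]//].
by apply/zero_point_amenable_lau; split => //; exact: zero_point_amenable_complex.
Qed.
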